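(* Let $\mathcal{E}$ be a finite-dimensional Euclidean space, let $\beta\in(0,\infty)$, let $y\in\mathcal{E}$, and let $S\subseteq\mathcal{E}$ be a closed convex set with $0\in\mathrm{int}\,S$. (i) If $\gamma_S(y)\neq 0$ and, at the point $\bar y=y/\gamma_S(y)$, the set $S$ is (locally) $\beta$-smooth w.r.t. $(\bar y,\zeta)$ for some unit normal vector $\zeta\in N_S(\bar y)$, then $\frac12\gamma_S^2$ is (locally) smooth with parameter $$\frac{1}{2(\zeta^T\bar y)^3}\left(\zeta^T\bar y+\beta\|\bar y\|^2+\sqrt{(\zeta^T\bar y+\beta\|\bar y\|^2)^2-4\beta(\zeta^T\bar y)^3}\right)$$ w.r.t. $(y,g)$, where $g=\nabla(\frac12\gamma_S^2)(y)=\frac{\gamma_S(y)\zeta}{\zeta^T\bar y}$. (ii) If $\gamma_S(y)=0$, then $\partial(\frac12\gamma_S^2)(y)=\{0\}$ and $\frac12\gamma_S^2$ is (locally) $\frac{1}{R(S)^2}$-smooth w.r.t. $(y,0)$.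
   Context: $\|\cdot\|$ is the Euclidean norm and $B(x,r)$ the closed ball of center $x$ and radius $r$. The gauge of $S$ is $\gamma_S(x)=\inf\{\lambda>0\mid x\in\lambda S\}$. The normal cone at $x\in S$ is $N_S(x)=\{\zeta\mid \zeta^T(z-x)\le 0\ \forall z\in S\}$; $\partial h(x)=\{g\mid h(z)-h(x)\ge g^T(z-x)\ \forall z\}$. $R(S)=\inf\{\|x\|\mid x\notin S\}\in(0,\infty]$, with $1/\infty=0$. Local smoothness of a set: for $\bar y\in\mathrm{bdry}\,S$ and unit $\zeta\in N_S(\bar y)$, $S$ is (locally) $\beta$-smooth w.r.t. $(\bar y,\zeta)$ if for every $\tilde\beta>\beta$ there is $\eta>0$ small enough that $B(\bar y-\frac1{\tilde\beta}\zeta,\frac1{\tilde\beta})\cap B(\bar y,\eta)\subseteq S\cap B(\bar y,\eta)$. Local smoothness of a function: a closed convex function $h$ is (locally) $L$-smooth w.r.t. $(x,g)$, where $g=\nabla h(x)$, if for every $\tilde L>L$ there is $\eta>0$ with $h(z)\le h(x)+g^T(z-x)+\frac{\tilde L}{2}\|z-x\|^2$ for all $z\in B(x,\eta)$. *)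

(* Defs.v *)
From HB Require Import structures.
From mathcomp Require Import all_boot all_order all_algebra sesquilinear.
From mathcomp Require Import all_classical all_reals all_analysis.

Set Implicit Arguments.
Unset Strict Implicit.
Unset Printing Implicit Defensive.

Import Order.TTheory GRing.Theory Num.Theory.
Import numFieldNormedType.Exports.
Local Open Scope classical_set_scope.
Local Open Scope ring_scope.

(* A finite-dimensional Euclidean space is a normed module E together with an
   inner product dot satisfying this predicate; zeta^T x is dot zeta x.  (The
   norm that the library puts on column vectors is the sup norm.) *)
Definition euclidean (R : realType) (E : normedModType R)
    (dot : {dot E for idfun}) : Prop :=
  (forall x : E, `|x| = Num.sqrt (dot x x)) /\
  (exists n : nat, inhabited (Vector.axiom n E)).

Section Definitions.
Variables (R : realType) (E : normedModType R) (dot : {dot E for idfun}).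
Implicit Types (S : set E) (x y z g zeta : E) (h : E -> R).

(* Real-valued: when 0 lies in the interior of S, the set of admissible l is
   nonempty for every x. *)
Definition gauge S x : R :=
  inf [set l : R | 0 < l /\ [set l *: s | s in S] x].

Definition half_sqr_gauge S x : R := 2^-1 * gauge S x ^+ 2.

Definition normal_cone S x : set E :=
  [set zeta | forall z, S z -> dot zeta (z - x) <= 0].

Definition subdifferential h x : set E :=
  [set g | forall z, h z - h x >= dot g (z - x)].

(* +oo when S is the whole space. *)
Definition inner_radius S : \bar R := ereal_inf [set `|x|%:E | x in ~` S].

(* 1 / R(S)^2, which is 0 when R(S) = +oo, by +oo^-1 = 0 in \bar R. *)
Definition inv_sqr_inner_radius S : R := fine ((inner_radius S ^+ 2)^-1)%E.

(* Meant for y on the boundary of S and a unit vector zeta in normal_cone S y. *)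
Definition set_locally_smooth S (beta : R) y zeta : Prop :=
  forall beta' : R, beta < beta' ->
  exists2 eta : R, 0 < eta &
    closed_ball (y - beta'^-1 *: zeta) beta'^-1 `&` closed_ball y eta
      `<=` S `&` closed_ball y eta.

Definition closed_convex_function h : Prop :=
  closed [set p : E * R | h p.1 <= p.2] /\
  convex_function [set: convex_lmodType E] h.

Definition is_gradient h x g : Prop := is_diff x (h : E -> R^o) (dot g).

Definition fun_locally_smooth h (L : R) x g : Prop :=
  [/\ closed_convex_function h,
      is_gradient h x g &
      forall L' : R, L < L' ->
      exists2 eta : R, 0 < eta &
        forall z, closed_ball x eta z ->
          h z <= h x + dot g (z - x) + L' / 2 * `|z - x| ^+ 2].

End Definitions.

(* Main.v *)
(** By homogeneity (i) reduces to the point [p = y / gauge S y].  To bound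
    [gauge S (p + d)] by [1 + mu] it suffices that [(p + d) / (1 + mu)] be in
    [S], and local smoothness gives this once that point is in the ball of
    radius [1 / beta'] tangent to [S] at [p].  For [mu] such that
    [(1 + mu)^2 ~ 1 + 2 <zeta, d> / a + L' |d|^2], membership in the ball
    amounts, to second order in [d], to
      [beta |d - (<zeta, d> / a) p|^2 + <zeta, d>^2 / a <= a L' |d|^2],
    and the largest eigenvalue of the quadratic form on the left is [a] times
    the constant of the statement (only the span of [zeta] and [p] matters).
    Conversely [zeta] being normal makes the announced gradient a subgradient,
    and the two bounds together give differentiability.
    For (ii), [gauge S z <= |z - y| / r] when [S] contains the ball of radius
    [r] about the origin. *)

Require Import Defs.
From mathcomp Require Import all_boot all_order all_algebra sesquilinear.
From mathcomp Require Import all_classical all_reals all_analysis.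
From mathcomp Require Import ring lra.
Set Implicit Arguments.
Unset Strict Implicit.
Unset Printing Implicit Defensive.

Import Order.TTheory GRing.Theory Num.Theory.
Import numFieldNormedType.Exports.
Local Open Scope classical_set_scope.
Local Open Scope ring_scope.

(** * Gauges of convex sets that contain a ball about the origin *)

Section Gauge.
Variables (R : realType) (E : normedModType R).
Implicit Types (S : set E) (x y : E) (l r t : R).

Lemma gauge_ge0 S x : 0 <= gauge S x.
Proof.
(* The infimum of the empty set is 0 by convention. *)
rewrite /gauge; set A := [set l | _]; have [->|/set0P A0] := eqVneq A set0.
  by rewrite inf0.
by apply: lb_le_inf => // l [/ltW].
Qed.

Lemma gauge_le S l x : 0 < l -> S (l^-1 *: x) -> gauge S x <= l.
Proof.
move=> l0 Sx; apply: ge_inf; first by exists 0 => k [/ltW].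
by split=> //; exists (l^-1 *: x) => //; rewrite scalerA divff ?scale1r ?gt_eqF.
Qed.

Lemma convex_setD S l t x y :
  convex_set (S : set (convex_lmodType E)) -> 0 <= l -> 0 <= t -> l + t = 1 ->
  S x -> S y -> S (l *: x + t *: y).
Proof.
move=> Sconvex l0 t0 lt1 Sx Sy.
have l1 : l <= 1 by lra.
have := Sconvex x y (Itv01 l0 l1); rewrite !inE => /(_ Sx Sy).
by rewrite /conv/= /unstable.onem -lt1 addrAC subrr add0r.
Qed.

Section BallInside.
Variables (S : set E) (r : R).
Hypotheses (r0 : 0 < r) (rS : forall x, `|x| < r -> S x).

Lemma ball_scale l x : 0 < l -> `|x| < l * r -> S (l^-1 *: x).
Proof.
move=> l0 xl; apply: rS; rewrite normrZ gtr0_norm ?invr_gt0//.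
by rewrite mulrC ltr_pdivrMr// mulrC.
Qed.

(** Elements of a set come arbitrarily close to its infimum. The set is nonempty since
    [(|x| + 1) / r] scales [x] into the ball of radius [r]. *)
Lemma gauge_gt_ex x l : gauge S x < l ->
  exists k, [/\ 0 < k, k < l & S (k^-1 *: x)].
Proof.
move=> xl; have [||k [k0 [s Ss sx]]] := @inf_adherent _
  [set l | 0 < l /\ [set l *: s | s in S] x] (l - gauge S x).
- by rewrite subr_gt0.
- split; last by exists 0 => k [/ltW].
  have k0 : 0 < (`|x| + 1) / r by rewrite divr_gt0// ltr_wpDl.
  exists ((`|x| + 1) / r); split=> //; exists (((`|x| + 1) / r)^-1 *: x).
    by apply: ball_scale; rewrite // divfK ?gt_eqF// ltrDl.
  by rewrite scalerA divff ?scale1r// gt_eqF.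
- rewrite -/(gauge S x) addrC subrK => kl; exists k; split => //.
  by rewrite -sx scalerA mulVf ?scale1r// gt_eqF.
Qed.

Lemma gauge_le_norm x : gauge S x <= `|x| / r.
Proof.
apply/ler_addgt0Pr => e e0.
have l0 : 0 < `|x| / r + e by rewrite ltr_wpDl// divr_ge0// ltW.
by apply: gauge_le => //; apply: ball_scale => //;
  rewrite mulrDl divfK ?gt_eqF// ltrDl mulr_gt0.
Qed.

Lemma gaugeZ t x : 0 < t -> gauge S (t *: x) = t * gauge S x.
Proof.
have le k z : 0 < k -> gauge S (k *: z) <= k * gauge S z.
  move=> k0; rewrite -ler_pdivrMl//; apply/ler_addgt0Pr => e e0.
  have [l [l0 lz Sz]] :=
    @gauge_gt_ex z (gauge S z + e) (ltac:(by rewrite ltrDl)).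
  rewrite ler_pdivrMl// (le_trans (@gauge_le _ (k * l) _ _ _)) ?mulr_gt0//.
    by rewrite scalerA invfM mulrAC mulVf ?mul1r// gt_eqF.
  by rewrite ler_pM2l// ltW.
(* The reverse inequality is [le] for the factor [t^-1] at the point [t *: x]. *)
move=> t0; apply/eqP; rewrite eq_le le//= -ler_pdivlMl//.
by apply: le_trans (le _ _ _); 
  rewrite ?invr_gt0// scalerA mulVf ?scale1r// gt_eqF.
Qed.

Hypothesis Sconvex : convex_set (S : set (convex_lmodType E)).

(** If [x / k] and [y / l] lie in [S], then [(x + y) / (k + l)] is their convex combination with
    weights [k / (k + l)] and [l / (k + l)]. *)
Lemma gaugeD x y : gauge S (x + y) <= gauge S x + gauge S y.
Proof.
apply/ler_addgt0Pr => e e0.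
have [|k [k0 kx Sx]] := @gauge_gt_ex x (gauge S x + e / 2); first by lra.
have [|l [l0 ly Sy]] := @gauge_gt_ex y (gauge S y + e / 2); first by lra.
have kl0 : 0 < k + l by lra.
apply: (@le_trans _ _ (k + l)); last by lra.
apply: gauge_le => //.
have -> : (k + l)^-1 *: (x + y)
    = (k / (k + l)) *: (k^-1 *: x) + (l / (k + l)) *: (l^-1 *: y).
  by rewrite !scalerA !(mulrAC _ (k + l)^-1) !divff ?gt_eqF// !mul1r scalerDr.
apply: convex_setD; rewrite ?divr_ge0 ?(ltW k0) ?(ltW l0) ?(ltW kl0)//.
by rewrite -mulrDl divff// gt_eqF.
Qed.

Lemma gauge_lipschitz x y : `|gauge S x - gauge S y| <= `|x - y| / r.
Proof.
have le u v : gauge S u - gauge S v <= `|u - v| / r.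
  rewrite lerBlDl -{1}(subrK v u) addrC (le_trans (gaugeD _ _))//.
  by rewrite lerD2l gauge_le_norm.
by rewrite ler_norml le andbT lerNl opprB distrC le.
Qed.

Lemma continuous_gauge : continuous (gauge S : E -> R^o).
Proof.
move=> x; apply/cvgrPdist_le => e e0; near=> z.
apply: le_trans (gauge_lipschitz _ _) _; rewrite ler_pdivrMr//.
near: z; exact: cvgr_dist_le (@cvg_id _ (nbhs x)) _ (mulr_gt0 e0 r0).
Unshelve. all: by end_near. Qed.

Lemma closed_convex_half_sqr_gauge : closed_convex_function (half_sqr_gauge S).
Proof.
split; last first.
  move=> t x y _ _; rewrite [X in _ <= X]convRE.
  rewrite /half_sqr_gauge /conv/= /unstable.onem.
  have u0 : 0 <= t%:num by [].
  have v0 : 0 <= 1 - t%:num by rewrite subr_ge0.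
  move: u0 v0; set u := t%:num => u0 v0.
  have g : gauge S (u *: x + (1 - u) *: y)
      <= u * gauge S x + (1 - u) * gauge S y.
    apply: le_trans (gaugeD _ _) _.
    have Z k z : 0 <= k -> gauge S (k *: z) <= k * gauge S z.
      rewrite le_eqVlt => /predU1P[<-|k0]; last by rewrite gaugeZ.
      by rewrite scale0r (le_trans (gauge_le_norm _))// normr0 !mul0r.
    by rewrite lerD// Z.
  move: g (gauge_ge0 S (u *: x + (1 - u) *: y)) v0.
  move: (gauge S _) (gauge S x) (gauge S y) => c a b g c0 v0.
  have : c ^+ 2 <= (u * a + (1 - u) * b) ^+ 2
    by rewrite ler_sqr ?nnegrE// (le_trans c0).
  (* This is the convexity gap of the square: [u a^2 + (1 - u) b^2 - (u a + (1 - u) b)^2]. *)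
  have : 0 <= u * (1 - u) * (a - b) ^+ 2
    by apply: mulr_ge0; [exact: mulr_ge0|exact: sqr_ge0].
  by lra.
(* The epigraph is closed as the preimage of a closed half-line under a continuous map. *)
rewrite (_ : [set p | _] =
    (fun p : E * R^o => p.2 - half_sqr_gauge S p.1) @^-1` [set t : R | 0 <= t]).
  apply: closed_comp (@closed_ge R 0) => p _; apply: cvgB; first exact: cvg_snd.
  have cg : (fun p : E * R^o => gauge S p.1 : R^o) @ p --> gauge S p.1.
    by apply: (@cvg_comp _ _ _ fst (gauge S : E -> R^o));
      [exact: cvg_fst|exact: continuous_gauge].
  by apply: cvgM; [exact: cvg_cst|rewrite expr2; apply: cvgM].
by apply/seteqP; split => p /=; rewrite subr_ge0.
Qed.
End BallInside.
End Gauge.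

(** * Inner products, and local smoothness from two-sided bounds *)

Section Euclidean.
Variables (R : realType) (E : normedModType R) (dot : {dot E for idfun}).
Hypothesis HE : euclidean dot.
Implicit Types (S : set E) (x y z u v g : E) (h : E -> R).

Lemma dotC u v : dot u v = dot v u.
Proof. by rewrite hermC expr0 mul1r. Qed.

Lemma dotZr t u v : dot u (t *: v) = t * dot u v.
Proof. by rewrite linearZ. Qed.

Lemma dotZl t u v : dot (t *: u) v = t * dot u v.
Proof. by rewrite dotC dotZr dotC. Qed.

Lemma dotxx u : dot u u = `|u| ^+ 2.
Proof.
rewrite HE.1 sqr_sqrtr//; have [->|u0] := eqVneq u 0; first by rewrite linear0.
by rewrite ltW// neq0_dnorm_gt0.
Qed.

Lemma normBZ_sqr t u v :
  `|u - t *: v| ^+ 2 = `|u| ^+ 2 - 2 * t * dot u v + t ^+ 2 * `|v| ^+ 2.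
Proof.
rewrite -!dotxx [X in X = _]linearB/= dotZr !(dotC (u - _)) !linearB/=.
rewrite !dotZr (dotC v u).
by ring.
Qed.

Lemma dot_sqr_le u v : dot u v ^+ 2 <= `|u| ^+ 2 * `|v| ^+ 2.
Proof.
have [->|v0] := eqVneq v 0; first by rewrite linear0 expr0n mulr_ge0 ?sqr_ge0.
have v2 : 0 < `|v| ^+ 2 by rewrite exprn_gt0 ?normr_gt0.
(* Cauchy-Schwarz: this vector is the component of [u] orthogonal to [v]. *)
have := sqr_ge0 `|u - (dot u v / `|v| ^+ 2) *: v|; rewrite normBZ_sqr => H.
rewrite -ler_pdivrMr//.
suff -> : dot u v ^+ 2 / `|v| ^+ 2 = `|u| ^+ 2 -
    (`|u| ^+ 2 - 2 * (dot u v / `|v| ^+ 2) * dot u v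
     + (dot u v / `|v| ^+ 2) ^+ 2 * `|v| ^+ 2) by lra.
by field; rewrite normr_eq0.
Qed.

Lemma dot_le_norm u v : `|dot u v| <= `|u| * `|v|.
Proof.
rewrite -ler_sqr ?nnegrE ?mulr_ge0// real_normK ?num_real// exprMn.
exact: dot_sqr_le.
Qed.

Lemma continuous_dot g : continuous (dot g : E -> R^o).
Proof.
apply: (@bounded_linear_continuous _ _ R^o); apply/linear_boundedP.
near=> r => x; apply: le_trans (dot_le_norm _ _) _; rewrite ler_wpM2r//.
Unshelve. all: by end_near. Qed.

(** The remainder of the affine approximation lies between 0 and [C |z - x|^2] near [x], hence is
    [o(|z - x|)]. *)
Lemma is_gradient_sandwich h x g C eta : 0 < eta ->
  subdifferential dot h x g ->
  (forall z, `|z - x| <= eta ->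
    h z <= h x + dot g (z - x) + C * `|z - x| ^+ 2) ->
  is_gradient dot h x g.
Proof.
move=> eta0 lo up.
have D : (h : E -> R^o) \o shift x
    = cst (h x : R^o) + (dot g : E -> R^o) +o_ 0 id.
  apply/eqaddoP => e e0; near=> z.
  have -> : ((h : E -> R^o) \o shift x
      - (cst (h x : R^o) + (dot g : E -> R^o))) z
      = h (z + x) - (h x + dot g z) by [].
  have := lo (z + x); rewrite addrK => l.
  rewrite ger0_norm; last by rewrite /=; lra.
  have /= := up (z + x); rewrite addrK => /(_ _) u.
  have : h (z + x) - (h x + dot g z) <= C * `|z| ^+ 2.
    by rewrite lerBlDl u.
  move=> /le_trans; apply; apply: (@le_trans _ _ (`|C| * `|z| ^+ 2)).
    by rewrite ler_wpM2r ?sqr_ge0// ler_norm.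
  rewrite expr2 mulrA ler_wpM2r//.
  (* The added 1 makes the divisor of [e] positive even when [C = 0]. *)
  apply: (@le_trans _ _ ((`|C| + 1) * `|z|)).
    by rewrite ler_wpM2r// lerDl.
  rewrite mulrC -ler_pdivlMr ?ltr_wpDl//; near: z.
  by apply: nbhs0_le; rewrite divr_gt0// ltr_wpDl.
have dE : 'd (h : E -> R^o) x = dot g :> (E -> R^o).
  exact: (diff_unique (@continuous_dot g)).
apply: DiffDef => //; apply/diff_locallyP; rewrite dE; split => //.
exact: continuous_dot.
Unshelve. all: by end_near. Qed.

Lemma fun_locally_smooth_sandwich h L x g :
  closed_convex_function h -> subdifferential dot h x g ->
  (forall L', L < L' -> exists2 eta, 0 < eta & forall z, `|z - x| <= eta ->
    h z <= h x + dot g (z - x) + L' / 2 * `|z - x| ^+ 2) ->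
  fun_locally_smooth dot h L x g.
Proof.
move=> hcc lo up; split => //.
  have [|eta eta0 ub] := up (L + 1); first by rewrite ltrDl.
  exact: is_gradient_sandwich eta0 lo ub.
move=> L' /up[eta eta0 ub]; exists eta => // z.
by rewrite closed_ballE// /closed_ball_/= distrC => /ub.
Qed.

(** * Points of zero gauge and the inner radius *)

Section ZeroGauge.
Variables (S : set E) (r : R).
Hypotheses (r0 : 0 < r) (rS : forall x, `|x| < r -> S x).
Hypothesis Sconvex : convex_set (S : set (convex_lmodType E)).

Lemma half_sqr_gauge_le_gauge0 y z : gauge S y = 0 ->
  half_sqr_gauge S z <= (r ^- 2) / 2 * `|z - y| ^+ 2.
Proof.
move=> y0; have : gauge S z <= `|z - y| / r.
  have := gauge_lipschitz r0 rS Sconvex z y.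
  by rewrite y0 subr0 => /(le_trans (ler_norm _)).
move=> le; rewrite /half_sqr_gauge.
suff : gauge S z ^+ 2 <= r ^- 2 * `|z - y| ^+ 2 by lra.
rewrite mulrC -exprVn -exprMn ler_sqr ?nnegrE ?gauge_ge0//.
exact: le_trans (gauge_ge0 _ _) le.
Qed.

Lemma subdifferential_gauge0 y : gauge S y = 0 ->
  subdifferential dot (half_sqr_gauge S) y = [set 0].
Proof.
move=> y0; have h0 : half_sqr_gauge S y = 0.
  by rewrite /half_sqr_gauge y0 expr0n mulr0.
apply/seteqP; split => g /=; last first.
  by move=> -> z; rewrite h0 subr0 dotC linear0 mulr_ge0 ?sqr_ge0.
move=> sub; apply/eqP; rewrite -normr_eq0; apply: contraT => g0.
have gg : 0 < `|g| ^+ 2 by rewrite exprn_gt0// lt_neqAle eq_sym g0/=.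
(* At [y + t *: g] the subgradient inequality asks for at least [t |g|^2], while the quadratic bound
   allows only half of that. *)
pose t := r ^+ 2; have t0 : 0 < t by rewrite exprn_gt0.
have := sub (y + t *: g); rewrite h0 subr0 addrAC subrr add0r dotZr dotxx.
have := half_sqr_gauge_le_gauge0 (y + t *: g) y0.
rewrite addrAC subrr add0r normrZ gtr0_norm// exprMn.
rewrite (_ : _ * _ = t * `|g| ^+ 2 / 2);
  last by rewrite /t; field; rewrite gt_eqF.
by have := mulr_gt0 t0 gg; lra.
Qed.

End ZeroGauge.

Lemma lt_inner_radius S x : (`|x|%:E < inner_radius S)%E -> S x.
Proof.
apply: contraPP => nSx; apply/negP; rewrite -leNgt.
by apply: ereal_inf_lbound; exists x.
Qed.

Lemma inner_radius_ge S r :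
  (forall x, `|x| < r -> S x) -> (r%:E <= inner_radius S)%E.
Proof.
move=> rS; apply: le_ereal_inf_tmp => _ [x nSx <-]; rewrite lee_fin leNgt.
by apply/negP => /rS.
Qed.

(** A finite inner radius is itself a valid [rho]. If it is infinite, [S] contains every point, and
    [rho] is chosen so that [rho ^- 2 = L]. *)
Lemma inv_sqr_inner_radius_lt S r L : 0 < r -> (forall x, `|x| < r -> S x) ->
  inv_sqr_inner_radius S < L ->
  exists rho, [/\ 0 < rho, (forall x, `|x| < rho -> S x) & rho ^- 2 <= L].
Proof.
move=> r0 /inner_radius_ge; rewrite /inv_sqr_inner_radius.
have := @lt_inner_radius S; case: (inner_radius S) => [rho| |].
- rewrite lee_fin => H /(lt_le_trans r0) rho0.
  rewrite -EFin_expe inver gt_eqF ?exprn_gt0//= => /ltW L1.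
  by exists rho; split => // x xr; apply: H; rewrite lte_fin.
- move=> H _ L0. have {}L0 : 0 < L.
    by move: L0; rewrite expeS mulyy invey.
  exists (Num.sqrt L)^-1; split; first by rewrite invr_gt0 sqrtr_gt0.
    by move=> x _; apply: H; rewrite ltry.
  by rewrite exprVn invrK sqr_sqrtr// ltW.
- by [].
Qed.

End Euclidean.

(** * Real inequalities behind the second-order bound *)

Section Scalars.
Variable R : realFieldType.
Implicit Types (a b s t u v : R).

(** Arithmetic-geometric mean: [(2 z)^2 <= 4 u v <= (u + v)^2]. *)
Lemma psd_form_ge0 u v z : 0 <= u -> 0 <= v -> z ^+ 2 <= u * v ->
  0 <= u + v + 2 * z.
Proof.
move=> u0 v0 zuv; rewrite -lerBlDl sub0r lerNl.
apply: le_trans (ler_norm _) _.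
rewrite -ler_sqr ?nnegrE ?addr_ge0// real_normK ?num_real//.
by have := sqr_ge0 (u - v); nra.
Qed.

Lemma mul_le_norm u v a b : `|u| <= a -> `|v| <= b -> `|u * v| <= a * b.
Proof. by move=> ua vb; rewrite normrM ler_pM. Qed.

Lemma small_mul c e : 0 <= c -> 0 < e ->
  exists2 t0, 0 < t0 & forall t, 0 <= t -> t <= t0 -> c * t <= e.
Proof.
move=> c0 e0; exists (e / (c + 1)); first by rewrite divr_gt0// ltr_wpDl.
move=> t t0; rewrite ler_pdivlMr ?ltr_wpDl// mulrDr mulr1 mulrC => ct.
by apply: le_trans ct; rewrite lerDl.
Qed.

(** Here [t], [s], [q], [rho] stand for [|d|], [<zeta, d>], [<p, d>], [|p|]. The last two
    conclusions will put [(p + d) / (1 + mu)] in the tangent ball and within [eta] of [p]. *)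
Lemma radial_step a rho beta L L' eps eta :
  0 < a -> 0 <= rho -> 0 <= beta -> L < L' -> 0 < eps -> 0 < eta ->
  exists2 t0, 0 < t0 & forall t s q, 0 <= t -> t <= t0 ->
    `|s| <= t -> `|q| <= rho * t ->
    beta * (t ^+ 2 - 2 * (s / a) * q + (s / a) ^+ 2 * rho ^+ 2) + s ^+ 2 / a
      <= (a * L - eps) * t ^+ 2 ->
    exists mu, [/\ 0 < 1 + mu,
      (1 + mu) ^+ 2 <= 1 + 2 * (s / a) + L' * t ^+ 2,
      beta / 2 * (t ^+ 2 - 2 * mu * q + mu ^+ 2 * rho ^+ 2)
        + (1 + mu) * (s - mu * a) <= 0 &
      t + `|mu| * rho <= (1 + mu) * eta].
Proof.
move=> a0 rho0 beta0 LL eps0 eta0.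
have [i iE] : exists i, i = a^-1 by exists a^-1.
have i0 : 0 < i by rewrite iE invr_gt0.
have i_ge0 := ltW i0.
have [K KE] : exists K, K = (`|L| + i ^+ 2) / 2 by exists ((`|L| + i ^+ 2) / 2).
have K0 : 0 <= K by rewrite KE divr_ge0// addr_ge0// sqr_ge0.
have iK : 0 <= i + K by rewrite addr_ge0// ltW.
pose C := beta / 2 * (2 * (K * rho) + 2 * (i * K) * rho ^+ 2 + K * K * rho ^+ 2)
  + a * ((i + K) * K).
have C0 : 0 <= C.
  rewrite /C.
  by do ?[apply: addr_ge0|apply: mulr_ge0|exact: sqr_ge0|exact: ltW].
have iKr : 0 <= 1 + (i + K) * rho by apply: addr_ge0 => //; exact: mulr_ge0.
have iKK : 0 <= 2 * (i * K) + K * K.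
  by apply: addr_ge0; do ?apply: mulr_ge0.
(* In turn, the thresholds secure [|mu| <= 1/2], closeness to [p], and control of the higher-order
   errors in the ball condition and in [(1 + mu)^2]; the bound 1 on [t] gives [t^2 <= t]. *)
have [t1 t1p H1] := small_mul iK (ltac:(lra) : 0 < 2^-1 :> R).
have [t2 t2p H2] := small_mul iKr (ltac:(lra) : 0 < eta / 2).
have [t3 t3p H3] := small_mul C0 (ltac:(lra) : 0 < eps / 2).
have [t4 t4p H4] := small_mul iKK (ltac:(lra) : 0 < L' - L).
exists (Num.min 1 (Num.min (Num.min t1 t2) (Num.min t3 t4))).
  by rewrite !lt_min ltr01 t1p t2p t3p t4p.
move=> t s q tge0; rewrite !le_min 
  => /and3P[le1 /andP[le2 le3] /andP[le4 le5]] st qt.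
have {H1 le2 t1 t1p} H1 := H1 _ tge0 le2.
have {H2 le3 t2 t2p} H2 := H2 _ tge0 le3.
have {H3 le4 t3 t3p} H3 := H3 _ tge0 le4.
have {H4 le5 t4 t4p} H4 := H4 _ tge0 le5.
pose x := s / a; have sx : s = x * a by rewrite /x divfK ?gt_eqF.
rewrite -/x => Q.
have xt : `|x| <= i * t by rewrite /x normrM -iE (gtr0_norm i0) mulrC ler_pM2l.
have t2 : 0 <= t ^+ 2 by rewrite sqr_ge0.
have t2t : t ^+ 2 <= t by rewrite expr2 ler_piMl.
(* Second-order expansion of [sqrt (1 + 2 x + L t^2) - 1]. *)
pose e := (L * t ^+ 2 - x ^+ 2) / 2.
have et : `|e| <= K * t ^+ 2.
  rewrite /e KE normrM [`|2^-1|]gtr0_norm// mulrAC ler_pM2r//.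
  apply: le_trans (ler_normB _ _) _; rewrite mulrDl lerD//.
    by rewrite normrM (ger0_norm t2).
  by rewrite normrX -exprMn ler_sqr ?nnegrE// mulr_ge0// ltW.
pose mu := x + e.
have mut : `|mu| <= (i + K) * t.
  apply: le_trans (ler_normD _ _) _; rewrite mulrDl lerD// (le_trans et)//.
  by rewrite ler_wpM2l.
have ee : `|e * e| <= K * K * t ^+ 2 * t.
  apply: le_trans (mul_le_norm et et) _.
  rewrite [leLHS](_ : _ = K * K * t ^+ 2 * t ^+ 2); last by ring.
  by rewrite ler_wpM2l// !mulr_ge0.
have xe := mul_le_norm xt et.
have qe := mul_le_norm qt et.
have me := mul_le_norm mut et.
have mu12 : `|mu| <= 2^-1 := le_trans mut H1.
exists mu; split.
- by move: mu12; rewrite ler_norml; lra.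
- have -> : (1 + mu) ^+ 2 = 1 + 2 * x + L * t ^+ 2 + 2 * (x * e) + e * e.
    by rewrite /mu; have -> : e = (L * t ^+ 2 - x ^+ 2) / 2 by []; field.
  have := ler_wpM2r t2 H4.
  move: xe ee; rewrite !ler_norml => /andP[_ xe] /andP[_ ee]; lra.
(* The second-order part is half the slack in [Q], at most [- eps / 2 * t ^+ 2]; the remainder is
   bounded by [C t^3]. *)
- have -> : beta / 2 * (t ^+ 2 - 2 * mu * q + mu ^+ 2 * rho ^+ 2)
      + (1 + mu) * (s - mu * a)
    = (beta * (t ^+ 2 - 2 * x * q + x ^+ 2 * rho ^+ 2) + s ^+ 2 / a
       - a * L * t ^+ 2) / 2
      + (beta / 2 * (- 2 * (q * e) + 2 * (x * e) * rho ^+ 2 + e * e * rho ^+ 2)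
         - a * (mu * e)).
    rewrite sx /mu; have -> : e = (L * t ^+ 2 - x ^+ 2) / 2 by [].
    by field; rewrite gt_eqF.
  have R1 : beta / 2 *
      (- 2 * (q * e) + 2 * (x * e) * rho ^+ 2 + e * e * rho ^+ 2)
    <= beta / 2 *
      (2 * (rho * t * (K * t ^+ 2)) + 2 * (i * t * (K * t ^+ 2)) * rho ^+ 2
       + K * K * t ^+ 2 * t * rho ^+ 2).
    rewrite ler_wpM2l ?divr_ge0// !lerD//.
    + by move: qe; rewrite ler_norml; lra.
    + rewrite ler_wpM2r ?sqr_ge0// ler_wpM2l// (le_trans (ler_norm _))//.
    + by rewrite ler_wpM2r ?sqr_ge0// (le_trans (ler_norm _)).
  have R2 : - (a * (mu * e)) <= a * ((i + K) * t * (K * t ^+ 2)).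
    by rewrite -mulrN ler_wpM2l// ?(ltW a0)//; move: me; rewrite ler_norml; lra.
  have := ler_wpM2r t2 H3; rewrite /C; lra.
- apply: (@le_trans _ _ (eta / 2)).
    apply: le_trans H2; rewrite mulrDl mul1r lerD2l mulrAC ler_wpM2r//.
  by rewrite mulrC ler_wpM2r ?(ltW eta0)//; move: mu12; rewrite ler_norml; lra.
Qed.
End Scalars.

(** Here [P], [n], [s], [q] stand for [|p|^2], [|d|^2], [<zeta, d>], [<p, d>]; the last hypothesis
    is Cauchy-Schwarz for the components of [p] and [d] orthogonal to [zeta]. *)
Lemma max_eigenvalue_bound (R : rcfType) (a beta P n s q : R) :
  let b := a + beta * P in
  0 < a -> 0 < beta -> a ^+ 2 <= P -> s ^+ 2 <= n ->
  (q - a * s) ^+ 2 <= (P - a ^+ 2) * (n - s ^+ 2) ->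
  beta * (n - 2 * (s / a) * q + (s / a) ^+ 2 * P) + s ^+ 2 / a
    <= a * (1 / (2 * a ^+ 3) * (b + Num.sqrt (b ^+ 2 - 4 * beta * a ^+ 3))) * n.
Proof.
move=> b a0 beta0 aP sn cs.
(* Up to the factor [a^4], the discriminant of a symmetric 2 by 2 matrix: squared difference of the
   diagonal entries plus four times the squared off-diagonal entry. It is therefore nonnegative. *)
have DE : b ^+ 2 - 4 * beta * a ^+ 3
    = (b - 2 * beta * a ^+ 2) ^+ 2 + (2 * beta * a) ^+ 2 * (P - a ^+ 2).
  by rewrite /b; ring.
have D0 : 0 <= (2 * beta * a) ^+ 2 * (P - a ^+ 2).
  by rewrite mulr_ge0 ?sqr_ge0 ?subr_ge0.
have Dge : (b - 2 * beta * a ^+ 2) ^+ 2 <= b ^+ 2 - 4 * beta * a ^+ 3.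
  by rewrite DE lerDl.
have Dpos := le_trans (sqr_ge0 _) Dge.
set w := Num.sqrt _; have w0 : 0 <= w by exact: sqrtr_ge0.
have w2 : w ^+ 2 = b ^+ 2 - 4 * beta * a ^+ 3 by rewrite sqr_sqrtr.
have : `|b - 2 * beta * a ^+ 2| <= w.
  by rewrite -ler_sqr ?nnegrE// w2 real_normK// num_real.
rewrite ler_norml => /andP[wl wr].
have a2 : 0 < 2 * a ^+ 2 by rewrite mulr_gt0// exprn_gt0.
(* The slack of the inequality is [X m + Y s^2 + 2 (beta / a) s r], where
   [m = n - s^2] and [r = q - a s]; [X] and [Y] are the distances of the largest
   eigenvalue to the diagonal entries, so [X Y] is the square of the
   off-diagonal entry. *)
pose X := (w + (b - 2 * beta * a ^+ 2)) / (2 * a ^+ 2).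
pose Y := (w - (b - 2 * beta * a ^+ 2)) / (2 * a ^+ 2).
have X0 : 0 <= X by rewrite divr_ge0// ?(ltW a2)//; lra.
have Y0 : 0 <= Y by rewrite divr_ge0// ?(ltW a2)//; lra.
have XY : X * Y = (beta / a) ^+ 2 * (P - a ^+ 2).
  have -> : X * Y = (w ^+ 2 - (b - 2 * beta * a ^+ 2) ^+ 2) / (4 * a ^+ 4).
    by rewrite /X /Y; field; rewrite gt_eqF.
  by rewrite w2 DE; field; rewrite gt_eqF.
rewrite -subr_ge0.
rewrite [leRHS](_ : _ = X * (n - s ^+ 2) + Y * s ^+ 2
  + 2 * (beta / a * s * (q - a * s))); last first.
  by rewrite /X /Y /b; field; rewrite gt_eqF.
apply: psd_form_ge0.
- by apply: mulr_ge0; rewrite ?subr_ge0.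
- by apply: mulr_ge0; rewrite ?sqr_ge0.
rewrite [leRHS](_ : _ = X * Y * (s ^+ 2 * (n - s ^+ 2))); last by ring.
rewrite XY.
rewrite [leLHS](_ : _ = (beta / a) ^+ 2 * s ^+ 2 * (q - a * s) ^+ 2);
  last by ring.
rewrite [leRHS](_ : _ = (beta / a) ^+ 2 * s ^+ 2
  * ((P - a ^+ 2) * (n - s ^+ 2))); last by ring.
by rewrite ler_wpM2l// mulr_ge0// sqr_ge0.
Qed.

(** * Second-order upper bound for the gauge at a smooth boundary point *)

Section SmoothPoint.
Variables (R : realType) (E : normedModType R) (dot : {dot E for idfun}).
Hypothesis HE : euclidean dot.
Variables (S : set E) (p zeta : E) (r : R).
Hypotheses (r0 : 0 < r) (rS : forall x, `|x| < r -> S x).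
Hypotheses (zeta1 : `|zeta| = 1) (pN : normal_cone dot S p zeta).

(** Testing the normal at the point [(r / 2) *: zeta] of [S] gives [r / 2 <= <zeta, p>]. *)
Lemma support_gt0 : 0 < dot zeta p.
Proof.
have : S ((r / 2) *: zeta).
  apply: rS; rewrite normrZ zeta1 mulr1 gtr0_norm ?divr_gt0//.
  by rewrite ltr_pdivrMr// ltr_pMr// ltr1n.
move=> /pN; rewrite linearB/= dotZr (dotxx HE) zeta1 expr1n mulr1 subr_le0.
by apply: lt_le_trans; rewrite divr_gt0.
Qed.

(** [S] lies in the half-space [<zeta, x> <= <zeta, p>], and a larger set has a smaller gauge. *)
Lemma support_le_gauge z : dot zeta z <= gauge S z * dot zeta p.
Proof.
rewrite -ler_pdivrMr ?support_gt0// leNgt; apply/negP.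
move=> /(gauge_gt_ex r0 rS)[k [k0]].
rewrite ltr_pdivlMr ?support_gt0// => lt /pN.
by rewrite linearB/= dotZr subr_le0 ler_pdivrMl// leNgt lt.
Qed.

Lemma dot_decomposition_le d :
  (dot p d - dot zeta p * dot zeta d) ^+ 2
    <= (`|p| ^+ 2 - dot zeta p ^+ 2) * (`|d| ^+ 2 - dot zeta d ^+ 2).
Proof.
have E1 (v : E) : `|v| ^+ 2 - dot zeta v ^+ 2 = `|v - dot zeta v *: zeta| ^+ 2.
  by rewrite (normBZ_sqr HE) zeta1 (dotC dot v); ring.
rewrite !E1; apply: le_trans (dot_sqr_le HE _ _).
rewrite le_eqVlt; apply/orP; left; apply/eqP; congr (_ ^+ 2).
rewrite [RHS]linearB/= dotZr !(dotC dot (p - _)) !linearB/=.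
rewrite !dotZr (dotxx HE) zeta1.
by rewrite (dotC dot d p) (dotC dot d zeta); ring.
Qed.

Variable beta : R.
Hypotheses (beta0 : 0 < beta) (Ssmooth : set_locally_smooth S beta p zeta).
Let a := dot zeta p.
Let b := a + beta * `|p| ^+ 2.
Let L := 1 / (2 * a ^+ 3) * (b + Num.sqrt (b ^+ 2 - 4 * beta * a ^+ 3)).

Lemma gauge_sqr_le L' : L < L' ->
  exists2 eta, 0 < eta & forall d, `|d| <= eta ->
    gauge S (p + d) ^+ 2 <= 1 + 2 * (dot zeta d / a) + L' * `|d| ^+ 2.
Proof.
move=> LL'; have a0 : 0 < a := support_gt0.
(* The gap between [L] and [L'] is shared: [M] leaves room for the expansion error, and
   [a * M - eps = a * L + eps] pays for replacing [beta] by [beta'], which costs at most [eps |d|^2]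
   by the choice of [c]. *)
pose M := (L + L') / 2; pose eps := a * (M - L) / 2.
have LM : L < M by rewrite /M; lra.
have ML' : M < L' by rewrite /M; lra.
have eps0 : 0 < eps by rewrite divr_gt0// mulr_gt0// subr_gt0.
pose c := (1 + `|p| / a) ^+ 2.
have c0 : 0 < c by rewrite exprn_gt0// ltr_wpDr// divr_ge0// ltW.
pose beta' := beta + eps / c.
have bb' : beta < beta' by rewrite ltrDl divr_gt0.
have b'0 : 0 < beta' by apply: lt_trans bb'.
have [eta eta0 ballS] := Ssmooth bb'.
have [t0 t00 step] := radial_step a0 (normr_ge0 p) (ltW b'0) ML' eps0 eta0.
exists t0 => // d dt0.
have zd : `|dot zeta d| <= `|d|.
  by have := dot_le_norm HE zeta d; rewrite zeta1 mul1r.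
have [|mu [mu0 mu1 mu2 mu3]] :=
    step _ (dot zeta d) (dot p d) (normr_ge0 d) dt0 zd (dot_le_norm HE p d).
  have nx : `|d| ^+ 2 - 2 * (dot zeta d / a) * dot p d
        + (dot zeta d / a) ^+ 2 * `|p| ^+ 2
      <= c * `|d| ^+ 2.
    rewrite (dotC dot p) -(normBZ_sqr HE) -exprMn ler_sqr ?nnegrE//; last first.
      by rewrite mulr_ge0// addr_ge0// divr_ge0// ltW.
    apply: le_trans (ler_normB _ _) _; rewrite mulrDl mul1r lerD2l.
    rewrite normrZ normrM.
    rewrite [`|a^-1|]gtr0_norm ?invr_gt0// mulrC -!mulrA ler_wpM2l// mulrC.
    by rewrite ler_wpM2l// invr_ge0 ltW.
  have ev : beta * (`|d| ^+ 2 - 2 * (dot zeta d / a) * dot p d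
        + (dot zeta d / a) ^+ 2 * `|p| ^+ 2)
      + dot zeta d ^+ 2 / a <= a * L * `|d| ^+ 2.
    apply: max_eigenvalue_bound => //; last exact: dot_decomposition_le.
      by have := dot_sqr_le HE zeta p; rewrite zeta1 expr1n mul1r.
    by have := dot_sqr_le HE zeta d; rewrite zeta1 expr1n mul1r.
  have : eps / c * (`|d| ^+ 2 - 2 * (dot zeta d / a) * dot p d
        + (dot zeta d / a) ^+ 2 * `|p| ^+ 2)
      <= eps * `|d| ^+ 2.
    rewrite [leRHS](_ : _ = eps / c * (c * `|d| ^+ 2));
      last by field; rewrite gt_eqF.
    by rewrite ler_wpM2l// divr_ge0// ltW.
  have -> : a * M - eps = a * L + eps by rewrite /eps; lra.
  by rewrite /beta'; lra.
apply: le_trans mu1; rewrite ler_sqr ?nnegrE ?gauge_ge0 ?(ltW mu0)//.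
apply: gauge_le => //.
pose l := 1 + mu; have l0 : 0 < l := mu0; rewrite -/l.
pose v := d - mu *: p.
have vE : l^-1 *: (p + d) - p = l^-1 *: v.
  apply: (@scalerI _ _ l); first by rewrite gt_eqF.
  rewrite scalerBr !scalerA divff ?gt_eqF// !scale1r /v /l scalerDl scale1r.
  by rewrite opprD addrACA subrr add0r.
have v2 : beta' / 2 * `|v| ^+ 2 + l * dot zeta v <= 0.
  by rewrite (normBZ_sqr HE) [dot zeta v]linearB/= dotZr (dotC dot d).
have vl : `|v| <= l * eta.
  by apply: le_trans mu3; apply: le_trans (ler_normB _ _) _; rewrite normrZ.
suff [] : (S `&` closed_ball p eta) (l^-1 *: (p + d)) by [].
apply: ballS; rewrite !closed_ballE// ?invr_gt0// /closed_ball_/=.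
split; last first.
  by rewrite distrC vE normrZ gtr0_norm ?invr_gt0// ler_pdivrMl.
have -> : p - beta'^-1 *: zeta - l^-1 *: (p + d)
    = - (l^-1 *: v - (- beta'^-1) *: zeta).
  by rewrite -vE scaleNr opprK opprD opprB addrAC.
rewrite normrN -ler_sqr ?nnegrE ?invr_ge0 ?(ltW b'0)// (normBZ_sqr HE).
rewrite zeta1 (dotC dot (_ *: v)) dotZr.
rewrite -subr_le0 normrZ exprMn gtr0_norm ?invr_gt0//.
(* The squared distance to the center minus the squared radius is a positive multiple of the left
   side of [v2]. *)
rewrite [leLHS](_ : _ = (2 / (beta' * l ^+ 2))
  * (beta' / 2 * `|v| ^+ 2 + l * dot zeta v)); last first.
  by field; rewrite !gt_eqF.
by rewrite pmulr_rle0// divr_gt0// mulr_gt0// exprn_gt0.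
Qed.

End SmoothPoint.

(** With [G = gauge S], the square [(G z - G y)^2 >= 0] gives
    [(G z^2 - G y^2) / 2 >= G y (G z - G y)], and the supporting half-space bounds [G z] from
    below. *)
Lemma normal_subdifferential (R : realType) (E : normedModType R)
    (dot : {dot E for idfun}) (HE : euclidean dot) (S : set E) (r : R)
    (y zeta : E) :
  let ybar := (gauge S y)^-1 *: y in
  0 < r -> (forall x, `|x| < r -> S x) -> 0 < gauge S y ->
  `|zeta| = 1 -> normal_cone dot S ybar zeta ->
  subdifferential dot (half_sqr_gauge S) y
    ((gauge S y / dot zeta ybar) *: zeta).
Proof.
move=> p r0 rS c0 zeta1 pN z; have a0 := support_gt0 HE r0 rS zeta1 pN.
have zp : dot zeta y = gauge S y * dot zeta p.
  by rewrite dotZr mulrA divff ?mul1r ?gt_eqF.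
have : gauge S y * (dot zeta z / dot zeta p) <= gauge S y * gauge S z.
  by rewrite ler_pM2l// ler_pdivrMr// (support_le_gauge HE r0 rS).
have := sqr_ge0 (gauge S z - gauge S y).
rewrite dotZl linearB/= zp /half_sqr_gauge mulrBr mulrAC -mulrA mulrA.
rewrite (_ : gauge S y / dot zeta p * (gauge S y * dot zeta p)
  = gauge S y ^+ 2); last first.
  by field; rewrite gt_eqF.
by rewrite -!mulrA; lra.
Qed.

Theorem theorem12 (R : realType) (E : normedModType R)
    (dot : {dot E for idfun}) (HE : euclidean dot)
    (beta : R) (beta_gt0 : 0 < beta) (y : E) (S : set E)
    (Sclosed : closed S) (Sconvex : convex_set (S : set (convex_lmodType E)))
    (S0 : interior S 0) :
  (gauge S y != 0 ->
    forall zeta : E,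
    let ybar := (gauge S y)^-1 *: y in
    let a := dot zeta ybar in
    let b := a + beta * `|ybar| ^+ 2 in
    `|zeta| = 1 -> normal_cone dot S ybar zeta ->
    set_locally_smooth S beta ybar zeta ->
    fun_locally_smooth dot (half_sqr_gauge S)
      (1 / (2 * a ^+ 3) * (b + Num.sqrt (b ^+ 2 - 4 * beta * a ^+ 3)))
      y ((gauge S y / a) *: zeta))
  /\
  (gauge S y = 0 ->
    subdifferential dot (half_sqr_gauge S) y = [set 0] /\
    fun_locally_smooth dot (half_sqr_gauge S) (inv_sqr_inner_radius S) y 0).
Proof.
have [r r0 rS] : exists2 r, 0 < r & forall x, `|x| < r -> S x.
  have /nbhs_ballP[r/= r0 rS] := S0; exists r => // x xr; apply: rS.
  by rewrite -ball_normE /ball_/= sub0r normrN.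
have hcc := closed_convex_half_sqr_gauge r0 rS Sconvex.
split=> [gy zeta p a b zeta1 pN smooth|gy].
  have c0 : 0 < gauge S y by rewrite lt_neqAle eq_sym gy gauge_ge0.
  apply: (fun_locally_smooth_sandwich HE hcc) => [|L' LL'].
    exact: (normal_subdifferential HE r0 rS).
  have a0 : 0 < a := support_gt0 HE r0 rS zeta1 pN.
  have [eta eta0 up] := gauge_sqr_le HE r0 rS zeta1 pN beta_gt0 smooth LL'.
  (* With [z = c *: (p + d)], the bound at [p + d] is multiplied by [c^2]. As [|d| = |z - y| / c],
     the radius scales by [c] and the quadratic constant is unchanged. *)
  exists (gauge S y * eta) => [|z zy]; first exact: mulr_gt0.
  pose c := gauge S y; rewrite -/c in c0 zy; rewrite -/c.
  pose d := c^-1 *: (z - y).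
  have dn : `|d| = c^-1 * `|z - y| by rewrite normrZ gtr0_norm ?invr_gt0.
  have zE : z = c *: (p + d).
    by rewrite /d /p -/c -scalerDr addrC subrK scalerA divff ?scale1r ?gt_eqF.
  have := up d; rewrite dn ler_pdivrMl// => /(_ zy).
  rewrite /half_sqr_gauge {2}zE (gaugeZ r0 rS)// -/c dotZl /d dotZr -/a !exprMn.
  move: (gauge S _) (dot zeta _) => G s GL.
  have := ler_wpM2l (sqr_ge0 c) GL.
  suff -> : c ^+ 2 * (1 + 2 * (c^-1 * s / a) + L' * (c^-1 ^+ 2 * `|z - y| ^+ 2))
    = c ^+ 2 + 2 * (c / a * s) + L' * `|z - y| ^+ 2 by lra.
  by field; rewrite !gt_eqF.
have sub := subdifferential_gauge0 HE r0 rS Sconvex gy.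
split=> //; apply: (fun_locally_smooth_sandwich HE hcc) => [|L'].
  by rewrite sub.
move=> /(inv_sqr_inner_radius_lt r0 rS)[rho [rho0 rhoS rhoL]].
(* The bound is global, so any radius serves. *)
exists 1 => // z _; rewrite dotC linear0 addr0.
apply: le_trans (half_sqr_gauge_le_gauge0 rho0 rhoS Sconvex z gy) _.
rewrite [half_sqr_gauge S y]/half_sqr_gauge gy expr0n mulr0 add0r.
by apply: ler_wpM2r; rewrite ?sqr_ge0// ler_wpM2r.
Qed.
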